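(* Let $F$ be a field of characteristic $2$. Let $\phi$ be an anisotropic quasilinear quadratic form of dimension $>1$ over $F$. Assume that $\phi$ is not a quasi-Pfister neighbour (that is, $h_{qp}(\phi)>0$). Then $i_1(\phi)\leq i_2(\phi)\leq\dots\leq i_{h_{qp}(\phi)}(\phi)$.
   Context: Let $F$ be a field of characteristic $2$. A quasilinear quadratic form over $F$ is a quadratic form $\phi\colon V_\phi\to F$ on a finite-dimensional $F$-vector space with $\phi(v+w)=\phi(v)+\phi(w)$ for all $v,w$ (equivalently, in a basis, $\phi=\langle a_1,\dots,a_n\rangle:=a_1X_1^2+\dots+a_nX_n^2$ with $a_i\in F$). It is isotropic if $\phi(v)=0$ for some $v\neq0$, anisotropic otherwise. The set of $v$ with $\phi(v)=0$ is a subspace whose dimension is denoted $i_0(\phi)$. $D(\phi)=\{\phi(v)\}$ is an $F^2$-subspace of $F$; the anisotropic part $\phi_{an}$ is the unique (up to isomorphism) anisotropic form with $D(\phi_{an})=D(\phi)$. $\phi$ is completely split if $\dim\phi_{an}=1$. $\phi_L$ denotes extension of scalars to a field extension $L/F$. If $\phi$ is not completely split and $\dim\phi>1$, $X_\phi=\{\phi=0\}\subset\mathbb P(V_\phi)$ is integral, and $F(\phi)$ is its function field. Standard splitting: for $\phi$ not completely split, set $F_0=F$, $\phi_0=\phi_{an}$ and inductively, as long as $\phi_{r-1}$ is not completely split, $F_r=F_{r-1}(\phi_{r-1})$, $\phi_r=((\phi_{r-1})_{F_r})_{an}$, and $i_r(\phi)=i_0((\phi_{r-1})_{F_r})$. The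 process stops at the first positive integer $h(\phi)$ with $\phi_{h(\phi)}$ completely split. $\psi$ is a subform of $\phi$ if there is an injective linear map $f\colon V_\psi\to V_\phi$ with $\phi\circ f=\psi$; forms $\psi,\phi$ are similar if $\psi\simeq a\phi$ for some $a\in F^*$. A quasi-Pfister form is $\langle 1\rangle$ or a tensor product $\langle 1,a_1\rangle\otimes\dots\otimes\langle 1,a_n\rangle$, $a_i\in F$. A form $\phi$ of dimension $>1$ is a quasi-Pfister neighbour if it is similar to a subform of a quasi-Pfister form $\pi$ with $2\dim\phi>\dim\pi$. $h_{qp}(\phi)$ is the smallest nonnegative integer $r$ such that $\phi_r$ is a quasi-Pfister neighbour (it exists, since $\phi_{h(\phi)-1}$ is always a quasi-Pfister neighbour). *)

(* Defs.v *)
From HB Require Import structures.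
From mathcomp Require Import all_boot all_order all_algebra.
From mathcomp Require Import boolp.
From mathcomp Require Import mpoly.
Set Implicit Arguments.
Unset Strict Implicit.
Unset Printing Implicit Defensive.
Import GRing.Theory.
Local Open Scope ring_scope.

(* The characteristic is part of the structure: outside characteristic 2 an
   additive quadratic form vanishes.  Additivity says that the polar form is 0,
   so no separate bilinearity axiom is needed. *)
Record qlform (F : fieldType) := QLForm {
  qlspace : vectType F;
  qlfun :> qlspace -> F;
  qlform_char2 : 2%N \in [pchar F];
  qlformD : forall v w, qlfun (v + w) = qlfun v + qlfun w;
  qlformZ : forall (c : F) v, qlfun (c *: v) = c ^+ 2 * qlfun v
}.

Definition qldim (F : fieldType) (phi : qlform F) : nat := \dim {:qlspace phi}.

(* <a_1, ..., a_n> *)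
Section Diagonal.
Variables (F : fieldType) (charF : 2%N \in [pchar F]).
Variables (n : nat) (a : n.-tuple F).

Definition diag_fun (v : 'rV[F]_n) : F := \sum_i tnth a i * v 0 i ^+ 2.

Lemma diag_funD v w : diag_fun (v + w) = diag_fun v + diag_fun w.
Proof.
rewrite /diag_fun -big_split /=; apply: eq_bigr => i _.
by rewrite mxE -(pFrobenius_autE charF) rmorphD /= !pFrobenius_autE mulrDr.
Qed.

Lemma diag_funZ c v : diag_fun (c *: v) = c ^+ 2 * diag_fun v.
Proof.
rewrite /diag_fun mulr_sumr; apply: eq_bigr => i _.
by rewrite mxE exprMn mulrCA.
Qed.

Definition diag_form : qlform F := QLForm charF diag_funD diag_funZ.
End Diagonal.

(* In the basis vbasis {:V}, phi is <a_1, ..., a_n> with (a_1, ..., a_n) equal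
   to qlcoefs phi. *)
Definition qlcoefs (F : fieldType) (phi : qlform F) : (qldim phi).-tuple F :=
  [tuple of map phi (vbasis {:qlspace phi})].

(* phi_L, on V (x)_F L written in coordinates. *)
Definition ql_ext (F L : fieldType) (iota : {rmorphism F -> L})
    (phi : qlform F) : qlform L :=
  diag_form (rmorph_pchar iota (qlform_char2 phi))
    [tuple of map iota (qlcoefs phi)].

Section Forms.
Variable F : fieldType.
Implicit Types phi psi pi : qlform F.

Definition isotropic phi : Prop :=
  exists2 v : qlspace phi, v != 0 & phi v = 0.

Definition anisotropic phi : Prop := ~ isotropic phi.

Lemma ql_zero_space_exists phi :
  exists U : {vspace qlspace phi}, forall v, (v \in U) = (phi v == 0).
Proof.
pose good (U : {vspace qlspace phi}) := forall v, v \in U -> phi v = 0.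
pose P d := `[< exists2 U, good U & \dim U = d >].
have exP : exists d, P d.
  exists 0%N; apply/asboolP; exists 0%VS; last by rewrite dimv0.
  by move=> v /[!memv0] /eqP ->; rewrite -[X in phi X](scale0r 0) qlformZ expr0n mul0r.
have ubP d : P d -> (d <= \dim {:qlspace phi})%N.
  by move=> /asboolP[U _ <-]; apply/dimvS/subvf.
case: (ex_maxnP exP ubP) => d /asboolP[U gU dU] maxd.
exists U => v; apply/idP/eqP => [/gU //|v0].
have /asboolP/maxd : exists2 W, good W & \dim W = \dim (U + <[v]>).
  exists (U + <[v]>)%VS => // w /memv_addP[u uU [x /vlineP[k ->] ->]].
  by rewrite qlformD qlformZ v0 mulr0 addr0 gU.
rewrite -dU => le_dim.
have /eqP-> : (U == U + <[v]>)%VS by rewrite eqEdim addvSl le_dim.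
by rewrite memvE addvSr.
Qed.

Definition ql_zero_space phi : {vspace qlspace phi} :=
  sval (cid (ql_zero_space_exists phi)).

(* i_0(phi) *)
Definition i0 phi : nat := \dim (ql_zero_space phi).

(* x \in D(phi) *)
Definition represents phi (x : F) : Prop := exists v, phi v = x.

Definition is_anisotropic_part phi psi : Prop :=
  anisotropic psi /\ (forall x, represents psi x <-> represents phi x).

Definition completely_split phi : Prop :=
  exists2 psi, is_anisotropic_part phi psi & qldim psi = 1%N.

Definition subform psi phi : Prop :=
  exists2 f : {linear qlspace psi -> qlspace phi},
    injective f & forall v, phi (f v) = psi v.

Definition isometric psi phi : Prop :=
  exists2 f : {linear qlspace psi -> qlspace phi},
    bijective f & forall v, phi (f v) = psi v.

Lemma ql_scaleD (a : F) phi v w :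
  a * phi (v + w) = a * phi v + a * phi w.
Proof. by rewrite qlformD mulrDr. Qed.

Lemma ql_scaleZ (a : F) phi c v : a * phi (c *: v) = c ^+ 2 * (a * phi v).
Proof. by rewrite qlformZ mulrCA. Qed.

Definition ql_scale (a : F) phi : qlform F :=
  QLForm (qlform_char2 phi) (@ql_scaleD a phi) (@ql_scaleZ a phi).

Definition similar psi phi : Prop :=
  exists2 a : F, a != 0 & isometric psi (ql_scale a phi).

(* <a_i>_i (x) <b_j>_j = <a_i b_j>_(i, j) *)
Definition diag_tensor (s t : seq F) : seq F := [seq x * y | x <- s, y <- t].

(* Coefficients of <1, a_1> (x) ... (x) <1, a_n>, which is <1> if n = 0. *)
Definition pfister_coefs (s : seq F) : seq F :=
  foldr (fun a => diag_tensor [:: 1; a]) [:: 1] s.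

Definition quasi_pfister pi : Prop :=
  exists s : seq F,
    isometric pi (diag_form (qlform_char2 pi) (in_tuple (pfister_coefs s))).

Definition quasi_pfister_neighbour phi : Prop :=
  (1 < qldim phi)%N /\
  exists pi psi, [/\ quasi_pfister pi, subform psi pi, similar phi psi
                   & (qldim pi < 2 * qldim phi)%N].

(* The equation of X_phi in the coordinates dual to vbasis {:V}. *)
Definition ql_poly phi : {mpoly F[qldim phi]} :=
  \sum_i tnth (qlcoefs phi) i *: 'X_i ^+ 2.

(* F(phi), up to F-isomorphism.  The field K contains the homogeneous
   coordinate ring F[X_1, ..., X_n] / (phi) of X_phi, via X_i |-> x_i, and L is
   the subfield of K of fractions f / g with f, g in this ring, homogeneous of
   the same degree, and g != 0. *)
Definition is_function_field phi (L : fieldType) (iota : {rmorphism F -> L})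
    : Prop :=
  exists (K : fieldType) (j : {rmorphism L -> K}) (x : 'I_(qldim phi) -> K),
    (forall p : {mpoly F[qldim phi]},
        mmap (j \o iota) x p = 0 <-> exists q, p = q * ql_poly phi) /\
    (forall z : K,
        (exists y : L, j y = z) <->
        exists (d : nat) (f g : {mpoly F[qldim phi]}),
          [/\ f \is d.-homog, g \is d.-homog, mmap (j \o iota) x g != 0
            & z = mmap (j \o iota) x f / mmap (j \o iota) x g]).

End Forms.

(* tower phi_r is the part of the standard splitting that starts at phi_r, an
   anisotropic form over F_r; the fields F_(r+1) and the forms phi_(r+1), which
   are unique up to isomorphism only, are chosen by the constructor. *)
Inductive tower : forall F : fieldType, qlform F -> Type :=
| tower_stop (F : fieldType) (phi : qlform F) :
    completely_split phi -> tower phi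
| tower_step (F : fieldType) (phi : qlform F)
    (L : fieldType) (iota : {rmorphism F -> L}) (phi' : qlform L) :
    ~ completely_split phi ->
    is_function_field phi iota ->
    is_anisotropic_part (ql_ext iota phi) phi' ->
    tower phi' -> tower phi.

(* [:: phi_0; phi_1; ...; phi_h] *)
Fixpoint tower_forms (F : fieldType) (phi : qlform F) (T : tower phi) :
    seq {K : fieldType & qlform K} :=
  match T with
  | tower_stop F phi _ => [:: existT _ F phi]
  | tower_step F phi L iota phi' _ _ _ T' => existT _ F phi :: tower_forms T'
  end.

(* [:: i_1; ...; i_h] *)
Fixpoint tower_indices (F : fieldType) (phi : qlform F) (T : tower phi) :
    seq nat :=
  match T with
  | tower_stop _ _ _ => [::]
  | tower_step F phi L iota phi' _ _ _ T' =>
      i0 (ql_ext iota phi) :: tower_indices T'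
  end.

Record standard_splitting (F : fieldType) (phi : qlform F) := StdSplitting {
  std_form0 : qlform F;
  std_form0P : is_anisotropic_part phi std_form0;
  std_tower : tower std_form0
}.

(* i_r, for 1 <= r <= h *)
Definition splitting_index (F : fieldType) (phi : qlform F)
    (S : standard_splitting phi) (r : nat) : nat :=
  nth 0%N (tower_indices (std_tower S)) r.-1.

(* The least r such that phi_r is a quasi-Pfister neighbour; if phi_0 is not
   completely split there is one, since phi_(h-1) is always such, so the default
   value of find is not reached. *)
Definition h_qp (F : fieldType) (phi : qlform F)
    (S : standard_splitting phi) : nat :=
  find (fun s => `[< quasi_pfister_neighbour (projT2 s) >])
    (tower_forms (std_tower S)).

(* Main.v *)
(* Let V = D(phi), a subspace of F over F^2, spanned by the coefficients a_i.
   A zero (c_i) of phi over F(phi) is given by homogeneous polynomials P_i with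
   sum_i a_i P_i^2 = Q q, where q is the equation of X_phi.  Substituting
   x + T e_j for the variables and comparing coefficients of T^2 gives
   Q(x) a_j = sum_i a_i (d_j P_i)(x)^2, so, up to a square, Q(x) multiplies
   V_1 = D(phi_1) into itself.  Independent zeros give independent values Q(x),
   so the stabilizer S of V_1 has degree at least i_1(phi) over the squares of
   F(phi).  Now S acts on the generic zero of phi_1 over F_2: either this
   produces i_1(phi) independent zeros, whence i_1(phi) <= i_2(phi), or
   V_1 = b S for some b, and then phi_1 is similar to a quasi-Pfister form. *)

From HB Require Import structures.
Require Import Defs.
From mathcomp Require Import all_boot all_order all_algebra.
From mathcomp Require Import boolp mpoly.
From mathcomp Require Import ring.
From mathcomp Require classical_sets.
Set Implicit Arguments.
Unset Strict Implicit.
Unset Printing Implicit Defensive.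
Import GRing.Theory.
Local Open Scope ring_scope.

(** * Additivity of squaring in characteristic 2 *)

Section CharTwo.
Variables (R : comNzRingType) (charR : 2%N \in [pchar R]).

Lemma sqrD2 (x y : R) : (x + y) ^+ 2 = x ^+ 2 + y ^+ 2.
Proof. by rewrite -!(pFrobenius_autE charR) rmorphD. Qed.

Lemma sqr_sum2 I (r : seq I) (P : pred I) (f : I -> R) :
  (\sum_(i <- r | P i) f i) ^+ 2 = \sum_(i <- r | P i) f i ^+ 2.
Proof.
rewrite -(pFrobenius_autE charR) rmorph_sum /=.
by apply: eq_bigr => i _; rewrite pFrobenius_autE.
Qed.

Lemma mpoly_char2 n : 2%N \in [pchar {mpoly R[n]}].
Proof. exact: (rmorph_pchar (@mpolyC n R) charR). Qed.

End CharTwo.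

(* In characteristic 2 these conditions imply that S is a subfield. *)
Definition sqr_subfield (F : fieldType) (S : F -> Prop) : Prop :=
  [/\ forall x y, S x -> S y -> S (x + y),
      forall x y, S x -> S y -> S (x * y) & forall x, S (x ^+ 2)].

(** * Functionals linear over a subfield containing the squares *)

Section Functional.
Variables (F : fieldType) (charF : 2%N \in [pchar F]) (S : F -> Prop).
Hypothesis subS : sqr_subfield S.

Lemma sqr_subfield0 : S 0.
Proof. by case: subS => _ _ /(_ 0); rewrite expr0n. Qed.

Lemma sqr_subfield1 : S 1.
Proof. by case: subS => _ _ /(_ 1); rewrite expr1n. Qed.

(** [x^-1] is [x] times the square of [x^-1]. *)
Lemma sqr_subfieldV x : S x -> S x^-1.
Proof.
case: subS => _ SM SX Sx; have [->|x0] := eqVneq x 0.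
  by rewrite invr0; exact: sqr_subfield0.
by rewrite -[x^-1]mul1r -(mulfV x0) -mulrA; apply: SM (SX x^-1).
Qed.

(** Zorn's lemma gives a maximal [S]-subspace [W] that contains [U] and avoids [v]. Maximality
    forces F = W + S v, and [tau] reads off the coefficient of [v]. *)
Lemma functional_exists (U : F -> Prop) (v : F) :
    U 0 -> (forall x y, U x -> U y -> U (x + y)) ->
    (forall s x, S s -> U x -> U (s * x)) -> ~ U v ->
  exists tau : {additive F -> F},
    [/\ forall s x, S s -> tau (s * x) = s * tau x,
        forall x, U x -> tau x = 0 & tau v = 1].
Proof.
case: (subS) => SD SM SX U0 UD UZ Uv.
pose good (X : F -> Prop) :=
  [/\ forall x, U x -> X x, forall x y, X x -> X y -> X (x + y),
      forall s x, S s -> X x -> X (s * x) & ~ X v].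
have gU : good U by split.
(* The empty chain has an empty union, which cannot contain [U]; so [good] is demanded of nonempty
   sets only. *)
have [] := @classical_sets.Zorn_bigcup F (fun X => (exists x, X x) -> good X).
  move=> C CP totC [x0 [X0 CX0 X0x0]].
  have gX X x : C X -> X x -> good X by move=> CX Xx; apply: (CP X CX); exists x.
  split.
  - by move=> x Ux; exists X0 => //; have [/(_ x Ux)] := gX _ _ CX0 X0x0.
  - move=> x y [X CX Xx] [Y CY Yy].
    have [XD YD] : (forall x y, X x -> X y -> X (x + y)) /\
                   (forall x y, Y x -> Y y -> Y (x + y)).
      by have [] := gX _ _ CX Xx; have [] := gX _ _ CY Yy.
    have [XY|YX] := totC _ _ CX CY.
      by exists Y => //; apply: YD => //; apply: XY.
    by exists X => //; apply: XD => //; apply: YX.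
  - move=> s x Ss [X CX Xx]; exists X => //.
    by have [_ _ XZ _] := gX _ _ CX Xx; apply: XZ.
  - by move=> [X CX Xv]; have [_ _ _ /(_ Xv)] := gX _ _ CX Xv.
move=> W [PW maxW].
have [UW WD WZ Wv] : good W.
  (* [W] is nonempty, since otherwise [U] would be a strictly larger good set. *)
  have [exW|nexW] := pselect (exists x, W x); first exact: PW.
  case: (maxW U) => //; split=> [x Wx|UW]; first by case: nexW; exists x.
  by apply: nexW; exists 0; exact: UW.
have oppF x : - x = x :> F by rewrite oppr_pchar2.
have decomp y : exists2 s, S s & W (y + s * v).
  have [Wy|nWy] := pselect (W y).
    by exists 0; [exact: sqr_subfield0 | rewrite mul0r addr0].
  (* [B] is W + S y. It is strictly larger than [W], so it contains [v], and the resulting relation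
     is solved for [y]. *)
  pose B z := exists2 s, S s & W (z + s * y).
  have WB x : W x -> B x.
    by move=> Wx; exists 0; [exact: sqr_subfield0 | rewrite mul0r addr0].
  have [s Ss Wvs] : B v.
    apply: contrapT => nBv; apply: (maxW B).
      split=> [x /WB //|/(_ y) BW]; apply/nWy/BW; exists 1.
        exact: sqr_subfield1.
      by rewrite mul1r -{2}[y]oppF subrr; apply: UW.
    move=> _; split => //.
    - by move=> x /UW/WB.
    - move=> x z [s Ss Wx] [t St Wz]; exists (s + t); first exact: SD.
      by rewrite mulrDl addrACA; apply: WD.
    - move=> t x St [s Ss Wx]; exists (t * s); first exact: SM.
      by rewrite -mulrA -mulrDr; apply: WZ.
  have s0 : s != 0.
    by apply/eqP => s0; apply: Wv; move: Wvs; rewrite s0 mul0r addr0.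
  exists s^-1; first exact: sqr_subfieldV.
  have := WZ _ _ (sqr_subfieldV Ss) Wvs.
  by rewrite mulrDr mulKf // addrC.
have uniq_coef y s t : S s -> S t -> W (y + s * v) -> W (y + t * v) -> s = t.
  move=> Ss St Ws Wt; have /eqP := oppF t; apply: contraTeq => st.
  apply/negP => _; apply: Wv.
  have st0 : s + t != 0 by rewrite -[t]oppF subr_eq0.
  have := WZ _ _ (sqr_subfieldV (SD _ _ Ss St)) (WD _ _ Ws Wt).
  by rewrite addrACA -{2}[y]oppF subrr add0r -mulrDl mulKf.
have [|tau tauP] := @choice F F (fun y s => S s /\ W (y + s * v)).
  by move=> y; have [s] := decomp y; exists s.
have tauE y s : S s -> W (y + s * v) -> tau y = s.
  by have [St Wt] := tauP y; move=> Ss Ws; apply: (uniq_coef y).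
have tau_add : zmod_morphism tau.
  move=> x y; rewrite !oppF; have [Sx Wx] := tauP x; have [Sy Wy] := tauP y.
  by apply: tauE; [exact: SD | rewrite mulrDl addrACA; apply: WD].
pose tauA := GRing.isZmodMorphism.Build _ _ tau tau_add.
pose tau' : {additive F -> F} := HB.pack tau tauA.
exists tau'; split=> [s x Ss | x Ux |] /=.
- have [Sx Wx] := tauP x; apply: tauE; first exact: SM.
  by rewrite -mulrA -mulrDr; apply: WZ.
- by apply: tauE; [exact: sqr_subfield0 | rewrite mul0r addr0; apply: UW].
- apply: tauE; first exact: sqr_subfield1.
  by rewrite mul1r -{2}[v]oppF subrr; apply: UW.
Qed.

End Functional.

(** * Applying a functional to the coefficients of polynomials *)

Section Coefficients.
Variables (F : fieldType) (charF : 2%N \in [pchar F]) (S : F -> Prop).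
Hypothesis subS : sqr_subfield S.
Variable n : nat.
Implicit Types p q : {mpoly F[n]}.

(** Squaring is additive, so a coefficient of [p ^+ 2] is 0 or the square of a coefficient of
    [p]. *)
Lemma mcoeff_sqr p m : S (p ^+ 2)@_m.
Proof.
case: (subS) => SD SM SX; rewrite [p]mpolyE sqr_sum2; last exact: mpoly_char2.
rewrite raddf_sum /=; elim/big_ind: _ => [||k _]; first exact: sqr_subfield0.
  exact: SD.
rewrite exprZn mcoeffZ; apply: SM; first exact: SX.
rewrite mcoeffXn; case: eqP => _; [exact: sqr_subfield1|exact: sqr_subfield0].
Qed.

Variable tau : {additive F -> F}.
Hypothesis tauZ : forall s x, S s -> tau (s * x) = s * tau x.

(** Each coefficient of [p * q] combines coefficients of [q] with factors in [S], which pass through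
    [tau]. Squares are the main source of such [p]. *)
Lemma map_mpoly_linearM p q :
  (forall m, S p@_m) -> map_mpoly tau (p * q) = p * map_mpoly tau q.
Proof.
move=> Sp; apply/mpolyP => m; rewrite mcoeff_map_mpoly !mcoeffM raddf_sum /=.
by apply: eq_bigr => k _; rewrite tauZ // mcoeff_map_mpoly.
Qed.

Lemma map_mpoly_linearZ c p :
  (forall m, S p@_m) -> map_mpoly tau (c *: p) = tau c *: p.
Proof.
move=> Sp; apply/mpolyP => m; rewrite mcoeff_map_mpoly !mcoeffZ.
by rewrite mulrC tauZ // mulrC.
Qed.

End Coefficients.

(** Linear independence over the field of squares; equivalently, the form <a_i> is anisotropic. *)
Definition sqr_indep (F : fieldType) n (a : 'I_n -> F) : Prop :=
  forall c : 'I_n -> F, \sum_i a i * c i ^+ 2 = 0 -> forall i, c i = 0.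

Lemma sqr_image_subfield (F : fieldType) :
  2%N \in [pchar F] -> sqr_subfield (fun x : F => exists y, x = y ^+ 2).
Proof.
move=> charF; split=> [_ _ [x ->] [y ->]|_ _ [x ->] [y ->]|x].
- by exists (x + y); rewrite sqrD2.
- by exists (x * y); rewrite exprMn.
- by exists x.
Qed.

(* Apply to all coefficients an F^2-linear functional that maps a i to 1 and
   the other a j to 0. *)
Lemma sqr_indep_dvd (F : fieldType) n N (a : 'I_N -> F)
    (P : 'I_N -> {mpoly F[n]}) (q R : {mpoly F[n]}) :
    2%N \in [pchar F] -> sqr_indep a ->
    \sum_i a i *: P i ^+ 2 = q ^+ 2 * R ->
  forall i, exists R', P i ^+ 2 = q ^+ 2 * R'.
Proof.
move=> charF inda eqP2 i.
have subS := sqr_image_subfield charF.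
pose U x := exists2 c : 'I_N -> F, c i = 0 & x = \sum_j a j * c j ^+ 2.
have [] := functional_exists charF subS (U := U) (v := a i).
- exists (fun=> 0) => //; rewrite big1 // => j _; by rewrite expr0n mulr0.
- move=> _ _ [c ci ->] [d di ->]; exists (fun j => c j + d j).
    by rewrite ci di addr0.
  by rewrite -big_split; apply: eq_bigr => j _; rewrite sqrD2 // mulrDr.
- move=> _ _ [s ->] [c ci ->]; exists (fun j => s * c j).
    by rewrite ci mulr0.
  by rewrite mulr_sumr; apply: eq_bigr => j _; rewrite exprMn mulrCA.
(* Since -1 = 1, an expression of [a i] by the other [a j] becomes a vanishing combination with
   coefficient 1 at [i]. *)
- move=> [c ci ai]; pose d j := if j == i then 1 else c j.
  have /(_ i) : forall j, d j = 0.
    apply: inda; rewrite (bigD1 i) //= /d eqxx expr1n mulr1.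
    rewrite {1}ai (bigD1 i) //= ci expr0n mulr0 add0r.
    rewrite [X in _ + X](eq_bigr (fun j => a j * c j ^+ 2)); last first.
      by move=> j /negPf->.
    by rewrite -[X in _ + X](oppr_pchar2 charF) subrr.
  by rewrite /d eqxx => /eqP; rewrite oner_eq0.
move=> tau [tauZ tauU taui].
have tauj j : tau (a j) = (j == i)%:R.
  have [->|ji] := eqVneq j i; first exact: taui.
  apply: tauU; exists (fun k => (k == j)%:R); first by rewrite eq_sym (negPf ji).
  rewrite (bigD1 j) //= eqxx expr1n mulr1 big1 ?addr0 // => k /negPf->.
  by rewrite expr0n mulr0.
exists (map_mpoly tau R).
rewrite -(map_mpoly_linearM tauZ); last exact: (mcoeff_sqr charF subS).
rewrite -eqP2 raddf_sum (bigD1 i) //= big1 => [|j ji].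
  rewrite addr0 (map_mpoly_linearZ tauZ) ?tauj ?eqxx ?scale1r //.
  exact: (mcoeff_sqr charF subS).
rewrite (map_mpoly_linearZ tauZ) ?tauj ?(negPf ji) ?scale0r //.
exact: (mcoeff_sqr charF subS).
Qed.

(** * Evaluation of polynomials and restriction to lines *)

Definition sqr_poly (F : fieldType) n (b : 'I_n -> F) : {mpoly F[n]} :=
  \sum_i b i *: 'X_i ^+ 2.

Section Evaluation.
Variables (F K : fieldType) (h : {rmorphism F -> K}) (n : nat) (x : 'I_n -> K).
Implicit Types p q : {mpoly F[n]}.

Lemma mmapM p q : mmap h x (p * q) = mmap h x p * mmap h x q.
Proof. by case: (mmap_is_multiplicative x h) => /(_ p q). Qed.

Lemma mmapXn2 p : mmap h x (p ^+ 2) = mmap h x p ^+ 2.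
Proof. by rewrite !expr2 mmapM. Qed.

Lemma mmap_sum I (r : seq I) (P : pred I) (f : I -> {mpoly F[n]}) :
  mmap h x (\sum_(i <- r | P i) f i) = \sum_(i <- r | P i) mmap h x (f i).
Proof. exact: raddf_sum. Qed.

Lemma mmap_var i : mmap h x 'X_i = x i.
Proof. by rewrite mmapX mmap1U. Qed.

Lemma mmap_sqr_poly N (b : 'I_N -> F) (P : 'I_N -> {mpoly F[n]}) :
  mmap h x (\sum_i b i *: P i ^+ 2) = \sum_i h (b i) * mmap h x (P i) ^+ 2.
Proof. by rewrite mmap_sum; apply: eq_bigr => i _; rewrite mmapZ mmapXn2. Qed.

Variable j : 'I_n.

(** The restriction of [p] to the line x + T e_j, with T = ['X]. Its first two coefficients are the
    values at [x] of [p] and of its [j]-th partial derivative. *)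
Definition line_eval p : {poly K} :=
  mmap (polyC \o h) (fun i => (x i)%:P + (i == j)%:R *: 'X) p.

Lemma line_eval0 : line_eval 0 = 0.
Proof. exact: mmap0. Qed.

Lemma line_evalD p q : line_eval (p + q) = line_eval p + line_eval q.
Proof. exact: mmapD. Qed.

Lemma line_evalM p q : line_eval (p * q) = line_eval p * line_eval q.
Proof.
by case: (mmap_is_multiplicative (fun i => (x i)%:P + (i == j)%:R *: 'X)
            (polyC \o h)) => /(_ p q).
Qed.

Lemma line_evalZ c p : line_eval (c *: p) = (h c)%:P * line_eval p.
Proof. exact: mmapZ. Qed.

Lemma line_eval_sum I (r : seq I) (P : pred I) (f : I -> {mpoly F[n]}) :
  line_eval (\sum_(i <- r | P i) f i) = \sum_(i <- r | P i) line_eval (f i).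
Proof. exact: (big_morph _ line_evalD line_eval0). Qed.

Lemma line_eval_var i : line_eval 'X_i = (x i)%:P + (i == j)%:R *: 'X.
Proof. by rewrite /line_eval mmapX mmap1U. Qed.

Lemma line_evalX m : line_eval 'X_[m] =
  (\prod_(i < n | i != j) x i ^+ m i)%:P * ((x j)%:P + 'X) ^+ m j.
Proof.
rewrite /line_eval mmapX /mmap1 (bigD1 j) //= mulrC eqxx scale1r rmorph_prod /=.
congr (_ * _); apply: eq_bigr => i /negPf->.
by rewrite scale0r addr0 rmorphXn.
Qed.

Lemma coef0_line p : (line_eval p)`_0 = mmap h x p.
Proof.
elim/mpolyind: p => [|c m p _ _ IH]; first by rewrite line_eval0 mmap0 coef0.
rewrite line_evalD coefD IH mmapD; congr (_ + _).
rewrite line_evalZ mmapZ coefCM line_evalX; congr (_ * _).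
rewrite coefCM mmapX /mmap1 [RHS](bigD1 j) //= [RHS]mulrC; congr (_ * _).
by rewrite -horner_coef0 !hornerE.
Qed.

Lemma deriv_line p : (line_eval p)^`() = line_eval (p^`M(j)).
Proof.
elim/mpolyind: p => [|c m p _ _ IH].
  by rewrite mderiv0 line_eval0 deriv0.
rewrite mderivD !line_evalD derivD IH; congr (_ + _).
rewrite mderivZ mderivX scalerA !line_evalZ !line_evalX.
rewrite mnmBE mnm1E eqxx subn1 rmorphM /= !mul_polyC.
rewrite !derivZ derivCE derivD derivC derivX add0r mul1r.
rewrite rmorph_nat -scalerA scaler_nat; congr (_ *: _).
rewrite scalerMnr; congr (_ *: _); apply: eq_bigr => i ij.
by rewrite mnmBE mnm1E eq_sym (negPf ij) subn0.
Qed.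

Lemma coef1_line p : (line_eval p)`_1 = mmap h x (p^`M(j)).
Proof. by rewrite -coef0_line -deriv_line coef_deriv mulr1n. Qed.

(** In characteristic 2, (x_j + T)^2 has no cross term, so only b_j T^2 is added to the value at
    [x]. *)
Lemma line_sqr_poly (charF : 2%N \in [pchar F]) (b : 'I_n -> F) :
  line_eval (sqr_poly b) = (mmap h x (sqr_poly b))%:P + (h (b j))%:P * 'X^2.
Proof.
have charK := rmorph_pchar h charF.
have charP := rmorph_pchar (@polyC K) charK.
rewrite /sqr_poly line_eval_sum mmap_sum rmorph_sum /= (bigD1 j) //=.
rewrite [in RHS](bigD1 j) //= [RHS]addrAC; congr (_ + _).
  rewrite mmapZ mmapXn2 mmap_var line_evalZ expr2 line_evalM -expr2 line_eval_var.
  by rewrite eqxx scale1r sqrD2 // mulrDr rmorphM rmorphXn.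
apply: eq_bigr => i /negPf ij.
rewrite mmapZ mmapXn2 mmap_var line_evalZ expr2 line_evalM -expr2 line_eval_var.
by rewrite ij scale0r addr0 rmorphM rmorphXn.
Qed.

End Evaluation.

(* Compare the coefficients of T^2 after substituting x + T e_j. *)
Lemma tangent_identity (F K : fieldType) (h : {rmorphism F -> K}) n N
    (x : 'I_n -> K) (b : 'I_n -> F) (s : 'I_N -> F)
    (P : 'I_N -> {mpoly F[n]}) (Q : {mpoly F[n]}) (j : 'I_n) :
    2%N \in [pchar F] -> mmap h x (sqr_poly b) = 0 ->
    \sum_k s k *: P k ^+ 2 = Q * sqr_poly b ->
  mmap h x Q * h (b j) = \sum_k h (s k) * mmap h x ((P k)^`M(j)) ^+ 2.
Proof.
move=> charF xb eqPQ.
have charK := rmorph_pchar h charF.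
have := congr1 (fun p => (line_eval h x j p)`_2) eqPQ.
rewrite /= line_evalM line_sqr_poly // xb polyC0 add0r mulrA coefMXn /= subnn.
rewrite coefMC coef0_line => <-.
rewrite line_eval_sum coef_sum; apply: eq_bigr => k _.
rewrite line_evalZ coefCM expr2 line_evalM -coef1_line; congr (_ * _).
(* The T^2-coefficient of (c_0 + c_1 T + c_2 T^2 + ...)^2 is c_1^2 + 2 c_0 c_2, and the cross term
   vanishes. *)
rewrite coefM !big_ord_recr big_ord0 /= add0r -[LHS]addrA addrC -addrA.
rewrite [X in _ + (X + _)]mulrC -mulr2n.
rewrite (_ : _ *+ 2 = 0) ?addr0 //.
by rewrite -mulr_natr (pcharf0 charK) mulr0.
Qed.

(** The factor ['X_i] restores the degree lost by differentiation, so that the quotient by a form of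
    degree [d] lies in the function field. *)
Lemma mderiv_homog (R : comNzRingType) n d (i j : 'I_n) (p : {mpoly R[n]}) :
  p \is d.-homog -> 'X_i * p^`M(j) \is d.-homog.
Proof.
move=> /dhomogP hp; rewrite [p]mpolyE raddf_sum /= mulr_sumr big_seq.
apply: rpred_sum => m mp; rewrite mderivZ mderivX scalerA -scalerAr.
have [m0|m0] := eqVneq (m j) 0%N; first by rewrite m0 mulr0 scale0r rpred0.
apply: dhomogZ; rewrite -mpolyXD dhomogX /=.
rewrite mdegD mdeg1 -[1%N](mdeg1 j) -mdegD addmC submK ?(hp _ mp) //.
by apply/mnm_lepP => k; rewrite mnm1E; case: eqP => [<-|//]; rewrite lt0n.
Qed.

Lemma prod_homog (R : comNzRingType) n (I : finType) (P : pred I) (d : I -> nat)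
    (p : I -> {mpoly R[n]}) :
  (forall i, p i \is (d i).-homog) ->
  \prod_(i | P i) p i \is (\sum_(i | P i) d i).-homog.
Proof.
move=> hp; elim/big_rec2: _ => [|i e q _ hq]; first exact: dhomog1.
exact: dhomogM.
Qed.

Lemma line_at_origin (F : fieldType) n (b : 'I_n -> F) j :
  2%N \in [pchar F] ->
  line_eval idfun (fun=> 0) j (sqr_poly b) = (b j)%:P * 'X^2.
Proof.
move=> charF; rewrite line_sqr_poly // [mmap _ _ _](_ : _ = 0) ?add0r //.
rewrite mmap_sum big1 // => i _.
by rewrite mmapZ mmapXn2 mmap_var expr0n mulr0.
Qed.

(** * Fractions and vanishing at the generic point of the quadric *)

Section FunctionField.
Variables (F K : fieldType) (h : {rmorphism F -> K}) (n : nat) (x : 'I_n -> K).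

(** Take the product of all denominators, and multiply each numerator by the denominators of the
    other indices; the degrees stay equal. *)
Lemma common_denominator (I : finType) (z : I -> K) :
    (forall i, exists (d : nat) (f g : {mpoly F[n]}),
      [/\ f \is d.-homog, g \is d.-homog, mmap h x g != 0
        & z i = mmap h x f / mmap h x g]) ->
  exists (d : nat) (g : {mpoly F[n]}) (f : I -> {mpoly F[n]}),
    [/\ g \is d.-homog, mmap h x g != 0, forall i, f i \is d.-homog
      & forall i, mmap h x (f i) = z i * mmap h x g].
Proof.
move=> frac; pose P i (t : nat * {mpoly F[n]} * {mpoly F[n]}) :=
  [/\ t.1.2 \is (t.1.1).-homog, t.2 \is (t.1.1).-homog, mmap h x t.2 != 0
    & z i = mmap h x t.1.2 / mmap h x t.2].
have [i|t tP] := choice (P := P).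
  by have [d [f [g]]] := frac i; exists (d, f, g).
have mmap_prod (A : pred I) (p : I -> {mpoly F[n]}) :
    mmap h x (\prod_(i | A i) p i) = \prod_(i | A i) mmap h x (p i).
  by apply: (big_morph (mmap h x) (mmapM h x)); rewrite -mpolyC1 mmapC; exact: rmorph1.
exists (\sum_i (t i).1.1)%N, (\prod_i (t i).2),
  (fun i => (t i).1.2 * \prod_(k | k != i) (t k).2); split.
- by apply: prod_homog => i; case: (tP i).
- by rewrite mmap_prod; apply/prodf_neq0 => i _; case: (tP i).
- move=> i; have -> : (\sum_k (t k).1.1 = (t i).1.1 + \sum_(k | k != i) (t k).1.1)%N.
    exact: bigD1.
  apply: dhomogM; first by case: (tP i).
  by apply: prod_homog => k; case: (tP k).
- move=> i; rewrite mmapM !mmap_prod [in RHS](bigD1 i) //= mulrA.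
  by case: (tP i) => _ _ g0 ->; rewrite divfK.
Qed.

Variables (b : 'I_n -> F).
Hypothesis kerE : forall p, mmap h x p = 0 <-> exists q, p = q * sqr_poly b.

Lemma mmap_sqr_poly0 : mmap h x (sqr_poly b) = 0.
Proof. by apply/kerE; exists 1; rewrite mul1r. Qed.

(** On the [j]-th axis through the origin, multiples of the quadric's equation are divisible by T^2,
    whereas X_j restricts to T. *)
Lemma coordinate_neq0 j : 2%N \in [pchar F] -> x j != 0.
Proof.
move=> charF; apply/eqP => xj0.
have /kerE[q /(congr1 (fun p => (line_eval idfun (fun=> 0) j p)`_1))] :
    mmap h x 'X_j = 0 by rewrite mmap_var.
rewrite /= line_evalM line_at_origin // line_eval_var eqxx scale1r add0r coefX.
by rewrite mulrA coefMXn => /eqP; rewrite oner_eq0.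
Qed.

(** If [Q] vanishes at [x], it is a multiple of the equation q, so q^2 divides the sum and hence
    each [P i ^+ 2]. This turns relations between the Q(x) into relations between the zeros. *)
Lemma sqr_indep_eval0 N (s : 'I_N -> F) (P : 'I_N -> {mpoly F[n]}) Q :
    2%N \in [pchar F] -> sqr_indep s ->
    \sum_i s i *: P i ^+ 2 = Q * sqr_poly b -> mmap h x Q = 0 ->
  forall i, mmap h x (P i) = 0.
Proof.
move=> charF inds eqPQ /kerE[R QE] i.
have [|R' /(congr1 (mmap h x))] := @sqr_indep_dvd _ _ _ s P (sqr_poly b) R charF inds _ i.
  by rewrite eqPQ QE expr2 mulrC mulrA mulrAC.
rewrite mmapXn2 mmapM mmapXn2 mmap_sqr_poly0 expr0n mul0r.
by move/eqP; rewrite expf_eq0 => /eqP.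
Qed.

End FunctionField.

(** * Forms in coordinates *)

Section Coordinates.
Variables (F : fieldType) (phi : qlform F).

Let a := tnth (qlcoefs phi).

Lemma qlform0 : phi 0 = 0.
Proof. by rewrite -(scale0r 0) qlformZ expr0n mul0r. Qed.

Lemma qlform_sum I (r : seq I) (P : pred I) (f : I -> qlspace phi) :
  phi (\sum_(i <- r | P i) f i) = \sum_(i <- r | P i) phi (f i).
Proof. exact: (big_morph _ (@qlformD _ phi) qlform0). Qed.

Lemma qlform_lincomb I (r : seq I) (P : pred I) (c : I -> F)
    (v : I -> qlspace phi) :
  phi (\sum_(i <- r | P i) c i *: v i) = \sum_(i <- r | P i) phi (v i) * c i ^+ 2.
Proof. by rewrite qlform_sum; apply: eq_bigr => i _; rewrite qlformZ mulrC. Qed.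

Lemma tnth_qlcoefs i : a i = phi (vbasis {:qlspace phi})`_i.
Proof. by rewrite /a tnth_map (tnth_nth 0). Qed.

Lemma represents_qlcoefs y :
  represents phi y <-> exists c, y = \sum_i a i * c i ^+ 2.
Proof.
split=> [[v <-]|[c ->]].
  exists (fun i => coord (vbasis {:qlspace phi}) i v).
  rewrite {1}(coord_vbasis (memvf v)) qlform_lincomb.
  by apply: eq_bigr => i _; rewrite tnth_qlcoefs.
exists (\sum_i c i *: (vbasis {:qlspace phi})`_i).
by rewrite qlform_lincomb; apply: eq_bigr => i _; rewrite tnth_qlcoefs.
Qed.

Lemma anisotropic_indep N (v : 'I_N -> qlspace phi) :
    anisotropic phi ->
    (forall c, \sum_i c i *: v i = 0 -> forall i, c i = 0) ->
  sqr_indep (fun i => phi (v i)).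
Proof.
move=> aphi freev c; rewrite -qlform_lincomb => phi0; apply: freev.
by apply/eqP; apply: contrapT => /negP v0; apply: aphi; exists (\sum_i c i *: v i).
Qed.

Lemma qlcoefs_indep : anisotropic phi -> sqr_indep a.
Proof.
move=> aphi c; under eq_bigr do rewrite tnth_qlcoefs.
apply: anisotropic_indep => // {}c c0 i.
by have /freeP freeb := basis_free (vbasisP {:qlspace phi}); apply: freeb c0 i.
Qed.

Lemma qlcoef_neq0 i : anisotropic phi -> a i != 0.
Proof.
move=> aphi; apply/eqP => ai0; suff /(_ i) /eqP : forall k, (k == i)%:R = 0 :> F.
  by rewrite eqxx oner_eq0.
apply: (qlcoefs_indep aphi); rewrite (bigD1 i) //= ai0 mul0r add0r big1 // => k.
by move=> /negPf->; rewrite expr0n mulr0.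
Qed.

Lemma indep_le_qldim N (s : 'I_N -> F) :
  sqr_indep s -> (forall i, represents phi (s i)) -> (N <= qldim phi)%N.
Proof.
move=> inds /choice[v vP].
pose X := [tuple v i | i < N].
have freeX : free X.
  apply/freeP => c; rewrite (eq_bigr (fun i => c i *: v i)); last first.
    by move=> i _; rewrite -tnth_nth tnth_mktuple.
  move=> /(congr1 phi); rewrite qlform_lincomb qlform0 => c0; apply: inds.
  by rewrite -[RHS]c0; apply: eq_bigr => i _; rewrite vP.
have := dimvS (subvf <<X>>); rewrite (eqP freeX) size_tuple /qldim.
exact.
Qed.

Lemma mem_ql_zero_space v : (v \in ql_zero_space phi) = (phi v == 0).
Proof. exact: (svalP (cid (ql_zero_space_exists phi))). Qed.

Lemma free_le_i0 N (v : 'I_N -> qlspace phi) :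
    (forall i, phi (v i) = 0) ->
    (forall c, \sum_i c i *: v i = 0 -> forall i, c i = 0) ->
  (N <= i0 phi)%N.
Proof.
move=> v0 freev.
pose X := [tuple v i | i < N].
have freeX : free X.
  apply/freeP => c; rewrite (eq_bigr (fun i => c i *: v i)); last first.
    by move=> i _; rewrite -tnth_nth tnth_mktuple.
  exact: freev.
have sX : (<<X>> <= ql_zero_space phi)%VS.
  apply/span_subvP => _ /tnthP[i ->]; rewrite tnth_mktuple.
  by rewrite mem_ql_zero_space v0.
by have := dimvS sX; rewrite (eqP freeX) size_tuple.
Qed.

End Coordinates.

(** * Multipliers obtained from the zeros over the function field *)

Lemma represents_ql_ext (F L : fieldType) (iota : {rmorphism F -> L})
    (phi : qlform F) y :
  represents (ql_ext iota phi) y <->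
  exists c : 'I_(qldim phi) -> L,
    y = \sum_i iota (tnth (qlcoefs phi) i) * c i ^+ 2.
Proof.
split=> [[v <-]|[c ->]]; [exists (v 0) | exists (\row_i c i)].
  by apply: eq_bigr => i _; rewrite tnth_map.
by apply: eq_bigr => i _; rewrite tnth_map mxE.
Qed.

Lemma stable_family (F L : fieldType) (iota : {rmorphism F -> L})
    (phi : qlform F) :
    anisotropic phi -> (0 < qldim phi)%N -> is_function_field phi iota ->
  exists s : 'I_(i0 (ql_ext iota phi)) -> L,
    sqr_indep s /\ forall k j,
      represents (ql_ext iota phi) (s k * iota (tnth (qlcoefs phi) j)).
Proof.
move=> aphi n_gt0 [K [j [x [kerE genE]]]].
have charF := qlform_char2 phi; have charL := rmorph_pchar iota charF.
have charK := rmorph_pchar j charL.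
set n := qldim phi in x kerE genE n_gt0 *; set a := tnth (qlcoefs phi).
have inda : sqr_indep a := qlcoefs_indep aphi.
pose h : {rmorphism F -> K} := j \o iota.
have {}kerE p : mmap h x p = 0 <-> exists q, p = q * sqr_poly a := kerE p.
have fracL (y : L) := proj1 (genE (j y)) (ex_intro _ y erefl).
pose o : 'I_n := Ordinal n_gt0.
have xo0 : x o != 0 := coordinate_neq0 kerE o charF.
have ao0 : a o != 0 by rewrite qlcoef_neq0.
set E := ql_ext iota phi; pose B := vbasis (ql_zero_space E).
pose c k i : L := (B`_k : 'rV[L]_n) 0 i.
(* [P k] is the [k]-th basis vector of the zero space over [L], cleared of denominators by [g]; by
   [kerE] its value is then a multiple [Q k] of the equation. *)
have [t|d [g [f [g_hom g0 f_hom fE]]]] :=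
    @common_denominator _ _ h _ x ('I_(i0 E) * 'I_n)%type
      (fun t => j (c t.1 t.2)).
  exact: fracL.
pose P k i := f (k, i).
have PE k i : mmap h x (P k i) = j (c k i) * mmap h x g by rewrite fE.
have [k|Q QE] := @choice 'I_(i0 E) _ (fun k q =>
    \sum_i a i *: P k i ^+ 2 = q * sqr_poly a).
  apply/kerE; rewrite mmap_sqr_poly.
  have : E B`_k = 0.
    by apply/eqP; rewrite -mem_ql_zero_space; apply/vbasis_mem/mem_nth; rewrite size_tuple.
  move=> /(congr1 j); rewrite rmorph0 rmorph_sum.
  move=> /(congr1 ( *%R^~ (mmap h x g ^+ 2))); rewrite mul0r mulr_suml => E0; rewrite -[RHS]E0.
  apply: eq_bigr => i _; rewrite PE exprMn mulrA; congr (_ * _).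
  by rewrite tnth_map rmorphM rmorphXn.
have tanE k i := tangent_identity i charF (mmap_sqr_poly0 kerE) (QE k).
(* The factor x_o / g(x) brings the partial derivatives of [P k] to degree 0, that is, into [L]. *)
have [t|sg sgE] := @choice ('I_(i0 E) * 'I_n * 'I_n)%type _ (fun t y =>
    j y = x o / mmap h x g * mmap h x ((P t.1.1 t.1.2)^`M(t.2))).
  apply/genE; exists d, ('X_o * (P t.1.1 t.1.2)^`M(t.2)), g; split=> //.
    by apply: mderiv_homog; apply: f_hom.
  by rewrite mmapM mmap_var mulrAC.
(* The tangent identity at coordinate [o], divided by [a o]: [s k] lies in [L] and is Q_k(x) times
   the square of x_o / g(x), a factor common to all [k]. *)
pose s k := (\sum_i iota (a i) * sg (k, i, o) ^+ 2) / iota (a o).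
have jsum k i : j (\sum_l iota (a l) * sg (k, l, i) ^+ 2) =
    (x o / mmap h x g) ^+ 2 * mmap h x (Q k) * h (a i).
  rewrite -mulrA tanE mulr_sumr rmorph_sum; apply: eq_bigr => l _.
  by rewrite rmorphM rmorphXn sgE exprMn mulrCA.
have sE k : j (s k) = (x o / mmap h x g) ^+ 2 * mmap h x (Q k).
  by rewrite fmorph_div jsum mulfK // fmorph_eq0.
exists s; split=> [m m0 k | k i]; last first.
  apply/represents_ql_ext; exists (fun l => sg (k, l, i)).
  by apply: (fmorph_inj j); rewrite rmorphM sE jsum.
(* Clearing denominators in a relation sum_k s_k m_k^2 = 0 shows that sum_k f'_k^2 Q_k vanishes at
   [x]. By [sqr_indep_eval0] so does sum_k f'_k P_k, hence the combination of basis zeros with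
   coefficients [m] is 0. *)
have [l|e [g' [f' [_ g'0 _ f'E]]]] :=
    @common_denominator _ _ h _ x 'I_(i0 E) (fun k => j (m k)).
  exact: fracL.
have mc0 i : \sum_k m k * c k i = 0.
  have : mmap h x (\sum_k f' k * P k i) = 0.
    pose P' l := \sum_k f' k * P k l.
    apply: (sqr_indep_eval0 kerE (s := a) (P := P')
              (Q := \sum_k f' k ^+ 2 * Q k) charF inda).
      rewrite mulr_suml.
      under eq_bigr do rewrite sqr_sum2 ?mpoly_char2 // scaler_sumr.
      rewrite exchange_big /=; apply: eq_bigr => l _.
      rewrite -mulrA -QE mulr_sumr; apply: eq_bigr => l' _.
      by rewrite exprMn scalerAr.
    rewrite mmap_sum; move/(congr1 j): m0; rewrite rmorph0 rmorph_sum => m0.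
    apply: (mulfI (x := (x o / mmap h x g) ^+ 2)).
      by rewrite expf_eq0 /= mulf_eq0 invr_eq0 negb_or xo0.
    move/(congr1 ( *%R (mmap h x g' ^+ 2))): m0; rewrite mulr0 mulr_sumr => m0.
    rewrite mulr0 -[RHS]m0.
    rewrite mulr_sumr.
    apply: eq_bigr => l _; rewrite rmorphM sE rmorphXn mmapM mmapXn2 f'E exprMn.
    by ring.
  rewrite mmap_sum => mc0; apply: (fmorph_inj j).
  apply: (mulIf (x := mmap h x g' * mmap h x g)); first by rewrite mulf_neq0.
  rewrite rmorph0 mul0r -mc0 rmorph_sum mulr_suml; apply: eq_bigr => l _.
  by rewrite mmapM f'E PE rmorphM; ring.
have /freeP freeB := basis_free (vbasisP (ql_zero_space E)).
apply: freeB => //; apply/rowP => i; rewrite mxE summxE -[RHS](mc0 i).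
by apply: eq_bigr => l _; rewrite mxE.
Qed.

(** * The stabilizer of the set of values and its action on zeros *)

Definition stabilizer (F : fieldType) (phi : qlform F) (x : F) : Prop :=
  forall y, represents phi y -> represents phi (x * y).

Section Stabilizer.
Variables (F : fieldType) (phi : qlform F).

Lemma representsD x y :
  represents phi x -> represents phi y -> represents phi (x + y).
Proof. by move=> [v <-] [w <-]; exists (v + w); rewrite qlformD. Qed.

Lemma representsZ c x : represents phi x -> represents phi (c ^+ 2 * x).
Proof. by move=> [v <-]; exists (c *: v); rewrite qlformZ. Qed.

Lemma represents0 : represents phi 0.
Proof. by exists 0; rewrite qlform0. Qed.

Lemma represents_sum I (r : seq I) (P : pred I) (f : I -> F) :
  (forall i, P i -> represents phi (f i)) ->
  represents phi (\sum_(i <- r | P i) f i).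
Proof.
by move=> Df; elim/big_ind: _; [exact: represents0|exact: representsD|].
Qed.

Lemma represents_qlcoef i : represents phi (tnth (qlcoefs phi) i).
Proof. by rewrite tnth_qlcoefs; exists (vbasis {:qlspace phi})`_i. Qed.

Lemma stabilizer_subfield : sqr_subfield (stabilizer phi).
Proof.
split=> [x y Sx Sy z Dz|x y Sx Sy z Dz|x z].
- by rewrite mulrDl; apply: representsD; [apply: Sx|apply: Sy].
- by rewrite -mulrA; apply/Sx/Sy.
- exact: representsZ.
Qed.

End Stabilizer.

(* If the zeros (s k) x over the function field are dependent, clearing
   denominators gives sum_k (s k) f_k^2 = Q q with Q(x) != 0; a functional
   linear over the stabilizer then turns q into a multiple of itself. *)
Lemma stable_family_le_i0 (F L : fieldType) (iota : {rmorphism F -> L})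
    (phi : qlform F) N (s : 'I_N -> F) :
    anisotropic phi -> (0 < qldim phi)%N -> is_function_field phi iota ->
    sqr_indep s -> (forall k, stabilizer phi (s k)) ->
  (N <= i0 (ql_ext iota phi))%N \/
  exists2 b, b != 0 & forall y, represents phi y <-> stabilizer phi (y / b).
Proof.
move=> aphi n_gt0 [K [j [x [kerE genE]]]] inds Ds.
have charF := qlform_char2 phi; have charL := rmorph_pchar iota charF.
have charK := rmorph_pchar j charL.
have subS := stabilizer_subfield phi.
have inda : sqr_indep (tnth (qlcoefs phi)) := qlcoefs_indep aphi.
have Da := @represents_qlcoef _ phi.
have [b bE] : exists b : 'I_(qldim phi) -> F, b = tnth (qlcoefs phi) by eexists.
have {}kerE p : mmap (j \o iota) x p = 0 <-> exists q, p = q * sqr_poly b.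
  by rewrite bE; apply: kerE.
have repE := represents_qlcoefs phi.
have repLE := represents_ql_ext iota phi.
rewrite -bE in inda Da repE repLE.
pose h : {rmorphism F -> K} := j \o iota.
have fracL (y : L) := proj1 (genE (j y)) (ex_intro _ y erefl).
pose o : 'I_(qldim phi) := Ordinal n_gt0.
have xo0 : x o != 0 := coordinate_neq0 kerE o charF.
have bo0 : b o != 0 by rewrite bE qlcoef_neq0.
(* If all ratios [b i / b o] stabilize, then D(phi) is [b o] times the stabilizer; otherwise [i1]
   marks a ratio outside it. *)
have [allS|] := pselect (forall i, stabilizer phi (b i / b o)).
  right; exists (b o) => // y; split=> [/repE[c ->]|/(_ (b o) (Da o))].
    have [SD SM SX] := subS; rewrite mulr_suml.
    elim/big_ind: _ => [||i _]; [exact: sqr_subfield0|exact: SD|].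
    by rewrite mulrAC; apply: SM.
  by rewrite divfK.
move=> /existsNP[i1 nS]; left.
have [t|sg sgE] := @choice ('I_N * 'I_(qldim phi))%type _ (fun t c =>
    s t.1 * b t.2 = \sum_i b i * c i ^+ 2).
  by apply/repE/Ds.
have {}sgE k i : s k * b i = \sum_l b l * sg (k, i) l ^+ 2 := sgE (k, i).
(* [Y k] is a linear map multiplying the values of [phi] by [s k], written at the generic point.
   Hence Y_k(x) / x_o is a zero over [L]. *)
pose Y k l := \sum_i sg (k, i) l *: ('X_i : {mpoly F[qldim phi]}).
have YE k : \sum_l b l *: Y k l ^+ 2 = s k *: sqr_poly b.
  rewrite /sqr_poly scaler_sumr.
  under eq_bigr do rewrite sqr_sum2 ?mpoly_char2 // scaler_sumr.
  rewrite exchange_big; apply: eq_bigr => i _.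
  rewrite scalerA sgE scaler_suml; apply: eq_bigr => l _.
  by rewrite exprZn scalerA.
have [t|Z ZE] := @choice ('I_N * 'I_(qldim phi))%type _ (fun t y =>
    j y = mmap h x (Y t.1 t.2) / x o).
  apply/genE; exists 1%N, (Y t.1 t.2), 'X_o; rewrite !mmap_var; split=> //.
    by apply: rpred_sum => i _; apply: dhomogZ; rewrite dhomogX /= mdeg1.
  by rewrite dhomogX /= mdeg1.
have {}ZE k l : j (Z (k, l)) = mmap h x (Y k l) / x o := ZE (k, l).
apply: (free_le_i0 (phi := ql_ext iota phi) (v := fun k => \row_l Z (k, l))).
  move=> k; apply: (fmorph_inj j); rewrite rmorph0 rmorph_sum.
  have := congr1 (mmap h x) (YE k).
  rewrite mmap_sqr_poly mmapZ mmap_sqr_poly0 // mulr0.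
  move=> /(congr1 ( *%R (x o ^- 2))); rewrite mulr0 mulr_sumr => Y0.
  rewrite -[RHS]Y0; apply: eq_bigr => l _.
  rewrite tnth_map -bE mxE rmorphM rmorphXn ZE expr_div_n.
  by rewrite mulrA mulrC.
move=> c c0; have [k|e [g [f [_ g0 _ fE]]]] :=
    @common_denominator _ _ h _ x 'I_N (fun k => j (c k)).
  exact: fracL.
(* A linear relation between these zeros, cleared of denominators, gives a polynomial vector that is
   a multiple of the equation. *)
have [l|H HE] := @choice _ _ (fun l q => \sum_k f k * Y k l = q * sqr_poly b).
  apply/kerE; rewrite mmap_sum.
  move/rowP/(_ l)/(congr1 j): c0; rewrite summxE mxE rmorph0 rmorph_sum.
  move=> /(congr1 ( *%R (x o * mmap h x g))); rewrite mulr0 mulr_sumr => c0.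
  rewrite -[RHS]c0; apply: eq_bigr => k _.
  rewrite !mxE [j _]rmorphM ZE mmapM fE.
  move: (mmap h x (Y k l)) (mmap h x g) (j (c k)) (x o) xo0 => y z w v v0.
  by field.
pose Q := \sum_l b l *: H l ^+ 2.
have q0 : sqr_poly b != 0.
  apply/eqP => /(congr1 (fun p => (line_eval idfun (fun=> 0) o p)`_2)).
  rewrite line_at_origin // line_eval0 coef0 coefMXn /= coefC /=.
  by move/eqP; rewrite (negPf bo0).
(* After multiplication by q, both sides equal sum_l b_l (sum_k f_k Y_kl)^2. *)
have QE : \sum_k s k *: f k ^+ 2 = Q * sqr_poly b.
  apply: (mulIf q0); rewrite mulr_suml -mulrA -expr2 mulr_suml.
  transitivity (\sum_l b l *: (\sum_k f k * Y k l) ^+ 2); last first.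
    by apply: eq_bigr => l _; rewrite HE exprMn scalerAl.
  under [RHS]eq_bigr do rewrite sqr_sum2 ?mpoly_char2 // scaler_sumr.
  rewrite exchange_big; apply: eq_bigr => k _.
  rewrite -scalerAl scalerAr -YE mulr_sumr; apply: eq_bigr => l _.
  by rewrite exprMn -scalerAr.
(* If Q(x) = 0, independence of the [s k] gives f_k(x) = 0, so [c k = 0]. The other case is refuted
   below. *)
have [Q0 k|Qx0] := eqVneq (mmap h x Q) 0.
  have := sqr_indep_eval0 kerE charF inds QE Q0 k; rewrite fE => /eqP.
  by rewrite mulf_eq0 (negPf g0) orbF fmorph_eq0 => /eqP.
exfalso.
have [SD SM SX] := subS.
(* [tau] kills the stabilizer and sends the ratio at [i1] to 1. Below, [p] is the equation
   normalized to coefficient 1 at [o], and [R * p] has its coefficients in the stabilizer. *)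
have [||||tau [tauZ tauS tau1]] :=
  functional_exists charF subS (U := stabilizer phi) (v := b i1 / b o) => //.
  exact: sqr_subfield0.
pose p := (b o)^-1 *: sqr_poly b; pose R := b o *: Q.
pose T := map_mpoly tau p.
have fS m : stabilizer phi (\sum_k s k *: f k ^+ 2)@_m.
  rewrite raddf_sum; elim/big_ind: _ => [||k _]; [exact: sqr_subfield0|exact: SD|].
  by rewrite /= mcoeffZ; apply: SM => //; apply: (mcoeff_sqr charF subS).
have sE : \sum_k s k *: f k ^+ 2 = R * p.
  by rewrite /R /p -scalerAl -scalerAr scalerA mulfV // scale1r.
(* Apply [tau] to (R p) p = p^2 R: the factors R p and p^2 have coefficients in the stabilizer and
   come out. Then cancel [p]. *)
have RT : R * T = p * map_mpoly tau R.
  have p0 : p != 0 by rewrite scaler_eq0 invr_eq0 (negPf bo0).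
  apply: (mulfI p0); rewrite mulrA [p * R]mulrC -sE.
  rewrite -(map_mpoly_linearM tauZ) // sE mulrA -expr2.
  rewrite -(map_mpoly_linearM tauZ); last exact: (mcoeff_sqr charF subS).
  by rewrite expr2 -mulrA mulrCA [R * p]mulrC mulrA.
(* At [x] the polynomial [p] vanishes and [R] does not, so [T] vanishes there. *)
have /kerE[r rE] : mmap h x T = 0.
  move/(congr1 (mmap h x)): RT; rewrite !mmapM !mmapZ mmap_sqr_poly0 //.
  rewrite mulr0 mul0r => /eqP; rewrite mulf_eq0 mulf_eq0 fmorph_eq0.
  by rewrite (negPf bo0) (negPf Qx0) => /eqP.
have TE : T = sqr_poly (fun i => tau (b i / b o)).
  rewrite /T /p /sqr_poly scaler_sumr raddf_sum; apply: eq_bigr => i _.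
  rewrite /= scalerA mulrC (map_mpoly_linearZ tauZ) //.
  exact: (mcoeff_sqr charF subS).
(* Compare quadratic coefficients along the axes. At [o] the left side is tau(1) = 0, so r(0) = 0;
   this contradicts the value 1 at [i1]. *)
have tauE i : tau (b i / b o) = mmap idfun (fun=> 0) r * b i.
  have := congr1 (fun p => (line_eval idfun (fun=> 0) i p)`_2) rE.
  rewrite /= TE line_evalM !line_at_origin // mulrA !coefMXn /= subnn.
  by rewrite coefMC coef0_line coefC.
have := tauE o; rewrite divff // tauS; last exact: sqr_subfield1.
move=> /esym/eqP; rewrite mulf_eq0 (negPf bo0) orbF => /eqP r0.
by move/eqP: (tauE i1); rewrite tau1 r0 mul0r oner_eq0.
Qed.

(** * Quasi-Pfister coefficient sequences and the subfields they span *)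

Section SeqForms.
Variable (F : fieldType).
Implicit Types (l t : seq F) (c : nat -> F).

(** Coordinates are functions on [nat], so that the second half of a sequence is reached by an index
    shift. *)
Definition seqval l c : F := \sum_(i < size l) l`_i * c i ^+ 2.

Definition seqspan l y : Prop := exists c, y = seqval l c.

Definition seq_indep l : Prop :=
  forall c, seqval l c = 0 -> forall i, (i < size l)%N -> c i = 0.

Lemma seqval_eq l c c' :
  (forall i, (i < size l)%N -> c i = c' i) -> seqval l c = seqval l c'.
Proof. by move=> cc'; apply: eq_bigr => i _; rewrite cc'. Qed.

Lemma seqval_pfister_cons a t c :
  seqval (pfister_coefs (a :: t)) c =
  seqval (pfister_coefs t) c
    + a * seqval (pfister_coefs t) (fun i => c (size (pfister_coefs t) + i)%N).
Proof.
rewrite /seqval /= /diag_tensor /= cats0; set l := pfister_coefs t.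
rewrite size_cat !size_map big_split_ord /= mulr_sumr; congr (_ + _).
  apply: eq_bigr => i _.
  by rewrite nth_cat size_map ltn_ord (nth_map 0) // mul1r.
apply: eq_bigr => i _.
by rewrite nth_cat size_map ltnNge leq_addr /= addKn (nth_map 0) // mulrA.
Qed.

Lemma size_pfister_coefs t : size (pfister_coefs t) = (2 ^ size t)%N.
Proof.
elim: t => //= a t IH.
by rewrite /diag_tensor /= cats0 size_cat !size_map IH expnS mul2n addnn.
Qed.

Lemma seqspan_pfister_cons a t y :
  seqspan (pfister_coefs (a :: t)) y <->
  exists u v, [/\ seqspan (pfister_coefs t) u, seqspan (pfister_coefs t) v
                & y = u + a * v].
Proof.
split=> [[c ->]|[_ [_ [[c ->] [d ->] ->]]]].
  rewrite seqval_pfister_cons.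
  set u := seqval _ c; set v := seqval _ (fun i => _).
  by exists u, v; split=> //; [exists c|exists (fun i => c (size (pfister_coefs t) + i)%N)].
set N := size (pfister_coefs t).
exists (fun i => if (i < N)%N then c i else d (i - N)%N).
rewrite seqval_pfister_cons; congr (_ + _ * _); apply: seqval_eq => i iN.
  by rewrite iN.
by rewrite ltnNge leq_addr /= addKn.
Qed.

Hypothesis charF : 2%N \in [pchar F].

(** By (u + a v)(w + a z) = (u w + a^2 v z) + a (u z + v w), each step adjoins [a]; the span is
    F^2(a_1, ..., a_n). *)
Lemma seqspan_pfister_subfield t : sqr_subfield (seqspan (pfister_coefs t)).
Proof.
elim: t => [|a t IH].
  have E y : seqspan (pfister_coefs [::]) y <-> exists x, y = x ^+ 2.
    split=> [[c ->]|[x ->]]; [exists (c 0%N)|exists (fun=> x)];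
    by rewrite /seqval big_ord1 mul1r.
  have [SD SM SX] := sqr_image_subfield charF.
  by split=> [x y /E Sx /E Sy|x y /E Sx /E Sy|x]; apply/E; auto.
have [SD SM SX] := IH.
split=> [_ _ /seqspan_pfister_cons[u [v [Su Sv ->]]]
             /seqspan_pfister_cons[w [z [Sw Sz ->]]]
        |_ _ /seqspan_pfister_cons[u [v [Su Sv ->]]]
             /seqspan_pfister_cons[w [z [Sw Sz ->]]]|x];
  apply/seqspan_pfister_cons.
- by exists (u + w), (v + z); split; [exact: SD|exact: SD|ring].
- exists (u * w + a ^+ 2 * (v * z)), (u * z + v * w); split; last ring.
    by apply: SD; apply: (SM) => //; apply: SM.
  by apply: SD; apply: SM.
- exists (x ^+ 2), 0; split; [exact: SX|exact: sqr_subfield0|].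
  by rewrite mulr0 addr0.
Qed.

Lemma seqspan_pfister_sub (S : F -> Prop) t :
    sqr_subfield S -> (forall x, x \in t -> S x) ->
  forall y, seqspan (pfister_coefs t) y -> S y.
Proof.
move=> [SD SM SX]; elim: t => [_ _ [c ->]|a t IH St y].
  by rewrite /seqval big_ord1 mul1r.
have {}IH : forall y, seqspan (pfister_coefs t) y -> S y.
  by apply: IH => x xt; apply: St; rewrite inE xt orbT.
move=> /seqspan_pfister_cons[u [v [/IH Su /IH Sv ->]]].
by apply: SD => //; apply: SM => //; apply: St; rewrite inE eqxx.
Qed.

(** If u + a v = 0 with v nonzero, then a = u / v lies in the subfield spanned by the tail. *)
Lemma seq_indep_pfister_cons a t :
    seq_indep (pfister_coefs t) -> ~ seqspan (pfister_coefs t) a ->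
  seq_indep (pfister_coefs (a :: t)).
Proof.
move=> indt nSa c; rewrite seqval_pfister_cons.
set N := size (pfister_coefs t).
set u := seqval _ c; set d := (fun i => _); set v := seqval _ d => uv.
have [SD SM SX] := seqspan_pfister_subfield t.
have Su : seqspan (pfister_coefs t) u by exists c.
have Sv : seqspan (pfister_coefs t) v by exists d.
have v0 : v = 0.
  apply: contrapT => /eqP v0; apply: nSa.
  suff -> : a = u * v^-1.
    by apply: SM => //; apply: sqr_subfieldV => //; exact: seqspan_pfister_subfield.
  apply: (mulIf v0); rewrite divfK //; apply/eqP.
  by rewrite -subr_eq0 oppr_pchar2 // addrC uv.
have u0 : u = 0 by rewrite -uv v0 mulr0 addr0.
move=> i; rewrite size_pfister_coefs expnS mul2n -addnn -size_pfister_coefs -/N.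
have [iN _|Ni iN] := ltnP i N; first exact: (indt c).
by have := indt d v0 (i - N)%N; rewrite /d -/N subnKC //; apply; rewrite ltn_subLR.
Qed.

Lemma seq_indep_pfister_nil : seq_indep (pfister_coefs [::]).
Proof.
move=> c; rewrite /seqval big_ord1 mul1r => /eqP.
by rewrite expf_eq0 => /eqP c0 [].
Qed.

Lemma diag_seqval l (v : 'rV[F]_(size l)) :
  diag_form charF (in_tuple l) v =
  seqval l (fun i => oapp (v 0) 0 (insub i)).
Proof. by apply: eq_bigr => i _; rewrite (tnth_nth 0) valK. Qed.

Lemma represents_diag_seq l y :
  represents (diag_form charF (in_tuple l)) y <-> seqspan l y.
Proof.
split=> [[v <-]|[c ->]].
  by exists (fun i => oapp ((v : 'rV[F]_(size l)) 0) 0 (insub i)); rewrite diag_seqval.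
exists (\row_i c i : 'rV[F]_(size l)).
by rewrite diag_seqval; apply: eq_bigr => i _; rewrite valK /= mxE.
Qed.

Lemma anisotropic_diag_seq l :
  seq_indep l -> anisotropic (diag_form charF (in_tuple l)).
Proof.
move=> indl [v /eqP v0]; rewrite diag_seqval => /indl c0; apply: v0.
apply/rowP => i; rewrite mxE; have := c0 i (ltn_ord i); by rewrite valK.
Qed.

End SeqForms.

(** * Recognizing quasi-Pfister forms by their values *)

Section Isometry.
Variable F : fieldType.
Implicit Types phi psi : qlform F.

Lemma isometric_refl phi : isometric phi phi.
Proof. by exists idfun => //; exists id. Qed.

Lemma anisotropic_inj phi v w : anisotropic phi -> phi v = phi w -> v = w.
Proof.
move=> aphi vw; apply: contrapT => /eqP vw0; apply: aphi.
exists (v - w); first by rewrite subr_eq0.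
have charF := qlform_char2 phi.
rewrite qlformD -scaleN1r qlformZ sqrrN expr1n mul1r -vw.
by rewrite -[X in _ + X](oppr_pchar2 charF) subrr.
Qed.

(** An anisotropic form is injective, so matching equal values defines a bijection, and injectivity
    also forces its linearity. *)
Lemma isometric_represents phi psi :
    anisotropic phi -> anisotropic psi ->
    (forall x, represents phi x <-> represents psi x) ->
  isometric phi psi.
Proof.
move=> aphi apsi repE.
have [v|f fE] := choice (P := fun v w => psi w = phi v).
  by apply/repE; exists v.
have [w|g gE] := choice (P := fun w v => phi v = psi w).
  by apply/repE; exists w.
have f_lin : linear f.
  move=> c v w; apply: (anisotropic_inj apsi).
  by rewrite qlformD qlformZ !fE qlformD qlformZ.
pose flin := GRing.isLinear.Build _ _ _ _ f f_lin.
pose f' : {linear qlspace phi -> qlspace psi} := HB.pack f flin.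
exists f' => //; exists g => [v|w] /=.
  by apply: (anisotropic_inj aphi); rewrite gE fE.
by apply: (anisotropic_inj apsi); rewrite fE gE.
Qed.

End Isometry.

(** Adjoining elements of [S] to the squares one at a time exhausts [S] by an anisotropic
    quasi-Pfister form, and [phi] is [b] times that form. *)
Lemma subfield_quasi_pfister_neighbour (F : fieldType) (phi : qlform F)
    (S : F -> Prop) (b : F) :
    anisotropic phi -> (1 < qldim phi)%N -> sqr_subfield S -> b != 0 ->
    (forall y, represents phi y <-> S (y / b)) ->
  quasi_pfister_neighbour phi.
Proof.
move=> aphi phi_gt1 subS b0 repE.
have charF := qlform_char2 phi.
have repM y : represents phi (b * y) <-> S y by rewrite repE [b * y]mulrC mulfK.
have [t [St indt]] : exists t,
    (forall y, seqspan (pfister_coefs t) y <-> S y)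
    /\ seq_indep (pfister_coefs t).
  (* If [S] were never exhausted, [qldim phi] adjunctions would give 2 ^ [qldim phi] independent
     values of [phi], too many. *)
  apply: contrapT => not_t.
  have {}not_t k : exists t, [/\ size t = k, forall x, x \in t -> S x
                                & seq_indep (pfister_coefs t)].
    elim: k => [|k [t [sz_t tS indt]]].
      by exists [::]; split=> //; exact: seq_indep_pfister_nil.
    have tsub := seqspan_pfister_sub subS tS.
    have [a Sa nSa] : exists2 a, S a & ~ seqspan (pfister_coefs t) a.
      apply: contrapT => noa; apply: not_t; exists t; split=> // y.
      split=> [/tsub //|Sy]; apply: contrapT => nSy; by apply: noa; exists y.
    exists (a :: t); split=> /=; first by rewrite sz_t.
      by move=> x; rewrite inE => /orP[/eqP->|/tS].
    exact: (seq_indep_pfister_cons charF indt nSa).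
  have [t [sz_t tS indt]] := not_t (qldim phi).
  have := @indep_le_qldim _ phi (size (pfister_coefs t))
            (fun i => b * (pfister_coefs t)`_i).
  rewrite size_pfister_coefs sz_t leqNgt ltn_expl //.
  rewrite -sz_t -size_pfister_coefs => contra; apply/notF/contra.
    move=> c; under eq_bigr do rewrite -mulrA.
    rewrite -mulr_sumr => /eqP; rewrite mulf_eq0 (negPf b0) => /eqP c0 i.
    have := indt (fun i => oapp c 0 (insub i)) _ i (ltn_ord i); rewrite valK.
    by apply; rewrite -[RHS]c0; apply: eq_bigr => k _; rewrite valK.
  move=> i; apply/repM/(seqspan_pfister_sub subS tS).
  exists (fun k => (k == i :> nat)%:R); rewrite /seqval (bigD1 i) //= eqxx.
  rewrite expr1n mulr1 big1 ?addr0 // => k /negPf ki.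
  by rewrite -val_eqE in ki; rewrite ki expr0n mulr0.
pose pi := diag_form charF (in_tuple (pfister_coefs t)).
have repi y : represents pi y <-> S y.
  by split=> [/(represents_diag_seq charF)/St|/St/(represents_diag_seq charF)].
have api : anisotropic pi := anisotropic_diag_seq indt.
split=> //; exists pi, pi; split.
- by exists t; exact: isometric_refl.
- by exists idfun => //.
- exists b => //; apply: isometric_represents => // [[v v0 /eqP]|y].
    by rewrite /= mulf_eq0 (negPf b0) => /eqP piv; apply: api; exists v.
  rewrite repE -repi; split=> [[v vy]|[v <-]].
    by exists v; rewrite -[RHS](divfK b0) -vy mulrC.
  by exists v; rewrite /= mulrAC divff // mul1r.
(* The multiples by [b] of the coefficients of [pi] are independent values of [phi], so dim pi <=
   dim phi. *)
- apply: (@leq_ltn_trans (qldim phi)); last by rewrite ltn_Pmull // ltnW.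
  apply: (@indep_le_qldim _ phi (qldim pi) (fun i => b * tnth (qlcoefs pi) i)).
    move=> c; under eq_bigr do rewrite -mulrA.
    rewrite -mulr_sumr => /eqP; rewrite mulf_eq0 (negPf b0) => /eqP.
    exact: qlcoefs_indep.
  by move=> i; apply/repM/repi; exact: represents_qlcoef.
Qed.

(** * Comparison of consecutive indices along the tower *)

Lemma represents_ql_ext_coef (F L : fieldType) (iota : {rmorphism F -> L})
    (phi : qlform F) i :
  represents (ql_ext iota phi) (iota (tnth (qlcoefs phi) i)).
Proof.
apply/represents_ql_ext; exists (fun k => (k == i)%:R).
rewrite (bigD1 i) //= eqxx expr1n mulr1 big1 ?addr0 // => k /negPf->.
by rewrite expr0n mulr0.
Qed.

Lemma stabilizer_ql_ext (F L : fieldType) (iota : {rmorphism F -> L})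
    (phi : qlform F) (s : L) :
    (forall j, represents (ql_ext iota phi) (s * iota (tnth (qlcoefs phi) j))) ->
  stabilizer (ql_ext iota phi) s.
Proof.
move=> Ds y /represents_ql_ext[c ->]; rewrite mulr_sumr.
by apply: represents_sum => i _; rewrite mulrA mulrC; apply: representsZ.
Qed.

Lemma qldim_gt0 (F : fieldType) (phi : qlform F) (y : F) :
  represents phi y -> y != 0 -> (0 < qldim phi)%N.
Proof.
move=> /represents_qlcoefs[c ->]; case: (posnP (qldim phi)) => // d0.
by rewrite big1 ?eqxx // => i; have := ltn_ord i; rewrite {2}d0.
Qed.

Lemma completely_split_dim1 (F : fieldType) (phi : qlform F) :
  anisotropic phi -> (0 < qldim phi)%N -> ~ completely_split phi ->
  (1 < qldim phi)%N.
Proof.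
move=> aphi phi_gt0 nsplit; rewrite ltn_neqAle phi_gt0 andbT eq_sym.
by apply/eqP => phi1; apply: nsplit; exists phi.
Qed.

(** The values over [L] form a line over the squares, so i_1 >= dim phi - 1, while the multipliers
    of [stable_family] give i_1 <= 1. Hence dim phi = 2, and <a, a'> is similar to <1, a'/a>. *)
Lemma completely_split_neighbour (F L : fieldType) (iota : {rmorphism F -> L})
    (phi : qlform F) (phi' : qlform L) :
    anisotropic phi -> (0 < qldim phi)%N -> ~ completely_split phi ->
    is_function_field phi iota -> is_anisotropic_part (ql_ext iota phi) phi' ->
    completely_split phi' ->
  quasi_pfister_neighbour phi.
Proof.
move=> aphi phi_gt0 nsplit funL [_ D'] [psi [_ Dpsi] psi1].
have charF := qlform_char2 phi; have charL := rmorph_pchar iota charF.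
have phi_gt1 := completely_split_dim1 aphi phi_gt0 nsplit.
have [s [inds Ds]] := stable_family aphi phi_gt0 funL.
set a := tnth (qlcoefs phi) in Ds.
pose o : 'I_(qldim phi) := Ordinal phi_gt0.
have ao0 : iota (a o) != 0 by rewrite fmorph_eq0 qlcoef_neq0.
have i0_le1 : (i0 (ql_ext iota phi) <= 1)%N.
  rewrite -psi1; apply: (indep_le_qldim (s := fun k => s k * iota (a o))).
    move=> c; under eq_bigr do rewrite mulrAC.
    rewrite -mulr_suml => /eqP; rewrite mulf_eq0 (negPf ao0) orbF => /eqP.
    exact: inds.
  by move=> k; apply/Dpsi/D'/Ds.
have reps i : represents psi (iota (a i)).
  exact/Dpsi/D'/represents_ql_ext_coef.
have [b bE] : exists b, forall y, represents psi y -> exists e, y = b * e ^+ 2.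
  pose p : 'I_(qldim psi) := Ordinal (eq_leq (esym psi1)).
  exists (tnth (qlcoefs psi) p) => y /represents_qlcoefs[c ->].
  exists (c p); rewrite (bigD1 p) //= big1 ?addr0 // => k kp.
  exfalso; move: kp; rewrite -val_eqE /=; have := ltn_ord k; rewrite {2}psi1.
  by case: (val k).
have [i|e eE] := choice (P := fun i z => iota (a i) = b * z ^+ 2); first exact: bE.
have eo0 : e o != 0.
  by apply: contra_neq ao0 => eo0; rewrite eE eo0 expr0n mulr0.
have : ((qldim phi).-1 <= i0 (ql_ext iota phi))%N.
  (* Since a_l = b e_l^2 over [L], the vector with entry e_k at [o] and e_o at k has value b (2 e_o
     e_k)^2 = 0. *)
  pose v k : 'rV[L]_(qldim phi) :=
    \row_l (e (lift o k) * (l == o)%:R + e o * (l == lift o k)%:R).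
  apply: (free_le_i0 (phi := ql_ext iota phi) (v := v)) => [k|c c0 k].
    have lo : lift o k != o by rewrite eq_sym neq_lift.
    have E l : tnth [tuple of [seq iota i | i <- qlcoefs phi]] l * v k 0 l ^+ 2
        = b * (e l * (e (lift o k) * (l == o)%:R + e o * (l == lift o k)%:R)) ^+ 2.
      by rewrite tnth_map mxE [iota _]eE exprMn -mulrA.
    rewrite /= /diag_fun (eq_bigr _ (fun l _ => E l)) -mulr_sumr -sqr_sum2 //.
    rewrite (bigD1 o) //= (bigD1 (lift o k)) //= big1 => [|l /andP[/negPf-> /negPf->]].
      rewrite !eqxx !mulr0 !mulr1 addr0 add0r addr0 [e (lift _ _) * _]mulrC.
      by rewrite -mulr2n (mulrn_pchar charL) expr0n mulr0.
    by rewrite !mulr0 addr0 mulr0.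
  move/rowP/(_ (lift o k)): c0; rewrite summxE mxE (bigD1 k) //= big1 => [|l lk].
    rewrite !mxE eqxx eq_sym (negPf (neq_lift o k)) mulr0 add0r mulr1 addr0.
    by move/eqP; rewrite mulf_eq0 (negPf eo0) orbF => /eqP.
  rewrite !mxE [_ == o]eq_sym (negPf (neq_lift o k)) (inj_eq lift_inj).
  by rewrite eq_sym (negPf lk) !mulr0 addr0 mulr0.
move=> /leq_trans /(_ i0_le1) le1.
have /eqP phi2 : qldim phi == 2 by rewrite eqn_leq phi_gt1 -(prednK phi_gt0) ltnS le1.
pose o' : 'I_(qldim phi) := Ordinal phi_gt1.
have ao : a o != 0 by rewrite qlcoef_neq0.
apply: (subfield_quasi_pfister_neighbour (b := a o) aphi phi_gt1
         (seqspan_pfister_subfield charF [:: a o' / a o])) => // y.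
have sum2 (f : 'I_(qldim phi) -> F) : \sum_i f i = f o + f o'.
  rewrite (bigD1 o) //= (bigD1 o') //= big1 ?addr0 // => l /andP[lo lo'].
  exfalso; move: lo lo'; rewrite -!val_eqE /=; have := ltn_ord l; rewrite {2}phi2.
  by case: (val l) => [|[|]].
split.
  move=> /represents_qlcoefs[c ->]; apply/seqspan_pfister_cons.
  exists (c o ^+ 2), (c o' ^+ 2).
  have [_ _ SX] := seqspan_pfister_subfield charF [::].
  by split; [exact: SX|exact: SX|rewrite sum2 -/a; field].
move=> /seqspan_pfister_cons[_ [_ [[c ->] [d ->] yE]]].
apply/represents_qlcoefs; exists (fun i => if i == o then c 0%N else d 0%N).
rewrite sum2 /= -[y](divfK ao) yE /seqval !big_ord1 /= -/a.
by field.
Qed.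

Lemma anisotropic_part_gt0 (F L : fieldType) (iota : {rmorphism F -> L})
    (phi : qlform F) (phi' : qlform L) :
  anisotropic phi -> (0 < qldim phi)%N ->
  is_anisotropic_part (ql_ext iota phi) phi' -> (0 < qldim phi')%N.
Proof.
move=> aphi phi_gt0 [_ D']; pose o : 'I_(qldim phi) := Ordinal phi_gt0.
apply: (qldim_gt0 (y := iota (tnth (qlcoefs phi) o))).
  exact/D'/represents_ql_ext_coef.
by rewrite fmorph_eq0 qlcoef_neq0.
Qed.

(** [phi'] has the values of [phi] over [L], so the multipliers of [stable_family] stabilize them;
    the second alternative of [stable_family_le_i0] would make [phi'] a neighbour. *)
Lemma second_index_ge (F L L' : fieldType) (iota : {rmorphism F -> L})
    (iota' : {rmorphism L -> L'}) (phi : qlform F) (phi' : qlform L) :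
    anisotropic phi -> (0 < qldim phi)%N -> is_function_field phi iota ->
    is_anisotropic_part (ql_ext iota phi) phi' -> ~ completely_split phi' ->
    is_function_field phi' iota' -> ~ quasi_pfister_neighbour phi' ->
  (i0 (ql_ext iota phi) <= i0 (ql_ext iota' phi'))%N.
Proof.
move=> aphi phi_gt0 funL [aphi' D'] nsplit funL' nqpn.
have [s [inds Ds]] := stable_family aphi phi_gt0 funL.
have stab k : stabilizer phi' (s k).
  by move=> y /D' Dy; apply/D'; apply: stabilizer_ql_ext Dy.
have phi'_gt0 := anisotropic_part_gt0 aphi phi_gt0 (conj aphi' D').
have [//|[b b0 Db]] := stable_family_le_i0 aphi' phi'_gt0 funL' inds stab.
case: nqpn; apply: subfield_quasi_pfister_neighbour b0 Db => //.
  exact: completely_split_dim1.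
exact: stabilizer_subfield.
Qed.

(** Lists are indexed from 0: entry [r] of the indices belongs to the step from form [r] to form
    [r.+1], and the bound on [find] says that neither these two forms nor the earlier ones are
    neighbours. *)
Lemma tower_indices_nondecreasing (F : fieldType) (phi : qlform F)
    (T : tower phi) (r : nat) :
    anisotropic phi -> (0 < qldim phi)%N ->
    (r.+1 < find (fun s => `[< quasi_pfister_neighbour (projT2 s) >])
              (tower_forms T))%N ->
  (nth 0 (tower_indices T) r <= nth 0 (tower_indices T) r.+1)%N.
Proof.
move: r; induction T as [F phi split0|F phi L iota phi' nsplit funL part T IH];
  move=> r aphi phi_gt0.
  (* With a single form, [find] is at most 1. *)
  by rewrite /=; case: asboolP.
have phi'_gt0 := anisotropic_part_gt0 aphi phi_gt0 part.
have aphi' : anisotropic phi' by case: part.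
rewrite /=; case: asboolP => //= nqpn; rewrite ltnS.
case: r => [|r]; last exact: IH.
clear IH; move: iota funL part aphi' phi'_gt0.
destruct T as [L1 phi1 split1|L1 phi1 L2 iota1 phi2 nsplit1 funL1 part1 T1];
  move=> iota funL part _ _.
  (* If the tower stops at the next form, the present one is already a neighbour. *)
  by case: nqpn; apply: completely_split_neighbour part split1.
rewrite /=; case: asboolP => // nqpn1 _.
exact: second_index_ge funL part nsplit1 funL1 nqpn1.
Qed.

Theorem theorem9p5 (F : fieldType) (charF : 2%N \in [pchar F])
    (phi : qlform F) (phi_aniso : anisotropic phi)
    (phi_dim : (1 < qldim phi)%N)
    (phi_nqpn : ~ quasi_pfister_neighbour phi)
    (S : standard_splitting phi) (r : nat)
    (r_gt0 : (0 < r)%N) (r_lt : (r < h_qp S)%N) :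
  (splitting_index S r <= splitting_index S r.+1)%N.
Proof.
case: r r_gt0 r_lt => // r _; case: S => phi0 [aphi0 D0] T.
apply: tower_indices_nondecreasing => //.
(* [phi0] represents the nonzero coefficients of [phi], so its dimension is positive. *)
pose o : 'I_(qldim phi) := Ordinal (ltnW phi_dim).
apply: qldim_gt0 (qlcoef_neq0 o phi_aniso).
by apply/D0; exact: represents_qlcoef.
Qed.
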